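(* Let $a<b$ be real numbers, let $I\subset\mathbb{R}$ be an open interval such that $[a,b]\subset I$ and let $f:I\to\mathbb{R}$ be a twice differentiable function such that $f''$ is bounded and integrable. Then $$\left|\int_a^b f(t)\,dt-\left[\frac{\sqrt2}{8}f(a)+\left(1-\frac{\sqrt2}{4}\right)f\left(\frac{a+b}{2}\right)+\frac{\sqrt2}{8}f(b)\right](b-a)\right|\le\frac{2-\sqrt2}{48}\,\|f''\|_\infty (b-a)^3,$$ where $\|f''\|_\infty=\sup_{t\in[a,b]}|f''(t)|$. *)

(* Defs.v *)
From HB Require Import structures.
From mathcomp Require Export all_boot all_order all_algebra.
From mathcomp Require Export all_classical all_reals all_analysis.
Export Order.TTheory GRing.Theory Num.Theory.
Export numFieldNormedType.Exports.

Set Implicit Arguments.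
Unset Strict Implicit.
Unset Printing Implicit Defensive.

Local Open Scope ring_scope.
Local Open Scope classical_set_scope.

(** A function on the open set [I] is represented by a total function; the
    values outside [I] are irrelevant, since derivability and the derivative at
    a point of [I] depend only on the values near that point. *)
Definition twice_differentiable_on (R : realType) (I : set R) (f : R -> R) :=
  forall x, I x -> derivable f x 1 /\ derivable f^`() x 1.

Definition sup_norm_on (R : realType) (a b : R) (g : R -> R) : R :=
  sup [set `|g t| | t in `[a, b]].

(* Main.v *)
Require Import Defs.
From mathcomp Require Import all_boot all_order all_algebra.
From mathcomp Require Import all_classical all_reals all_analysis.
From mathcomp Require Import ring lra.
Import Order.TTheory GRing.Theory Num.Theory.
Import numFieldNormedType.Exports.

Local Open Scope ring_scope.
Local Open Scope classical_set_scope.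

(** Since the second derivative [f^`(2)] need not be continuous, the classical
    Peano kernel identity, error = integral of [K * f^`(2)], is replaced by a
    comparison of derivatives that holds at every point.

    Let [F] be a primitive of [f].  For a quadratic [q] with [q'' = 1], the
    function [F - q' f + q f'] has derivative [q f''], because the terms in [f]
    and [f'] cancel.  If [|f''| <= M], this function therefore varies no faster
    than [M] times a primitive of [|q|]; the mean value theorem suffices to see
    it ([increment_le_of_norm_derive_le]), as soon as [q] has a constant sign on
    the segment considered ([peano_increment_le]).

    Take [q] with roots [a] and [a + d] on the left half of the segment, and
    with roots [b - d] and [b] on the right half.  The two quadratics agree at
    the midpoint, so the terms in [f'] cancel there, and they vanish at the
    endpoints, so no other term in [f'] appears: the increments add up to the
    error of the rule with weights [d / 2], [b - a - d], [d / 2].  This bounds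
    the error by [M] times the integral of [|q|], for every [d] less than half
    the length of the segment ([three_point_rule_le]).  The theorem is the case
    [d = sqrt 2 / 4 * (b - a)], the value that minimises this bound; [F] is then
    the integral of [f] from [a]. *)

Lemma increment_le_of_norm_derive_le {R : realType} (G g P p : R -> R)
    (u v : R) (uv : u < v)
    (dG : forall x, x \in `]u, v[%R -> is_derive x 1 G (g x))
    (dP : forall x, x \in `]u, v[%R -> is_derive x 1 P (p x))
    (cG : {within `[u, v], continuous G})
    (cP : {within `[u, v], continuous P})
    (gp : forall x, x \in `]u, v[%R -> `|g x| <= p x) :
  `|G v - G u| <= P v - P u.
Proof.
have cB : {within `[u, v], continuous (fun x => P x - G x)}.
  by move=> x; apply: continuousB; [exact: cP|exact: cG].
have cD : {within `[u, v], continuous (fun x => P x + G x)}.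
  by move=> x; apply: continuousD; [exact: cP|exact: cG].
have [x xuv xE] := MVT uv (fun x xi => is_deriveB (dP x xi) (dG x xi)) cB.
have [y yuv yE] := MVT uv (fun x xi => is_deriveD (dP x xi) (dG x xi)) cD.
have := gp _ xuv; rewrite ler_norml => /andP[_ gpx].
have := gp _ yuv; rewrite ler_norml => /andP[gpy _].
have x0 : 0 <= (p x - g x) * (v - u) by apply: mulr_ge0; lra.
have y0 : 0 <= (p y + g y) * (v - u) by apply: mulr_ge0; lra.
rewrite -xE in x0; rewrite -yE in y0; rewrite !fctE in x0 y0.
by rewrite ler_norml; apply/andP; split; lra.
Qed.

(** With [q x = (x - p) * (x - r) / 2], this is [F - q' f + q g]; its derivative
    is [q g'] when [F' = f] and [f' = g]. *)
Definition peano_increment {R : realType} (F f g : R -> R) (p r x : R) : R :=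
  F x - (x - (p + r) / 2) * f x + (x - p) * (x - r) / 2 * g x.

(** The primitive of [(x - p) * (x - r) / 2] that vanishes at [p]. *)
Definition peano_area {R : realType} (p r x : R) : R :=
  (x - p) ^+ 3 / 6 - (r - p) * (x - p) ^+ 2 / 4.

(** The derivative of the left-hand function is [q k], of absolute value at most
    [M |q|].  The factor [e], equal to [1] or [-1] where [q] is nonzero, records
    the sign of [q], so that [e * peano_area] is a primitive of [|q|]. *)
Lemma peano_increment_le {R : realType} (F f g k : R -> R) (u v p r e M : R)
    (uv : u < v)
    (dF : forall x, x \in `]u, v[%R -> is_derive x 1 F (f x))
    (cF : {within `[u, v], continuous F})
    (df : forall x, x \in `[u, v]%R -> is_derive x 1 f (g x))
    (dg : forall x, x \in `[u, v]%R -> is_derive x 1 g (k x))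
    (kM : forall x, x \in `[u, v]%R -> `|k x| <= M)
    (sign_e : forall x, x \in `]u, v[%R ->
       `|(x - p) * (x - r) / 2| = e * ((x - p) * (x - r) / 2)) :
  `|peano_increment F f g p r v - peano_increment F f g p r u|
    <= M * e * (peano_area p r v - peano_area p r u).
Proof.
have sub x : x \in `]u, v[%R -> x \in `[u, v]%R by apply: subset_itv_oo_cc.
pose G x := - ((x - (p + r) / 2) * f x) + (x - p) * (x - r) / 2 * g x.
have dG x : x \in `[u, v]%R ->
    is_derive x 1 G (- f x + (x - p) * (x - r) / 2 * k x).
  move=> xuv; have dfx := df _ xuv; have dgx := dg _ xuv.
  rewrite /G; apply: is_derive_eq.
  by rewrite /GRing.scale/=; field.
have cG : {within `[u, v], continuous G}.
  by apply: derivable_within_continuous => x /dG[].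
have dA (x : R) : is_derive x 1 (fun x => M * e * peano_area p r x)
    (M * (e * ((x - p) * (x - r) / 2))).
  rewrite /peano_area; apply: is_derive_eq.
  by rewrite /GRing.scale/=; field.
rewrite mulrBr; pose K x := (x - p) * (x - r) / 2 * k x.
have PE x : peano_increment F f g p r x = F x + G x.
  by rewrite /peano_increment /G addrA.
have dS x : x \in `]u, v[%R -> is_derive x 1 (fun y => F y + G y) (K x).
  move=> xuv; have dFx := dF _ xuv; have dGx := dG _ (sub _ xuv).
  by apply: is_derive_eq; rewrite /K; ring.
have cS : {within `[u, v], continuous (fun y => F y + G y)}.
  by move=> x; apply: continuousD; [exact: cF|exact: cG].
have cA : {within `[u, v], continuous (fun x => M * e * peano_area p r x)}.
  by apply: derivable_within_continuous => x _; case: (dA x).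
rewrite !PE.
apply: (increment_le_of_norm_derive_le _ _ _ _ _ _ uv dS (fun x _ => dA x) cS cA).
move=> x xuv; rewrite /K normrM sign_e// mulrC ler_wpM2r ?kM ?sub//.
by rewrite -sign_e.
Qed.

(** The kernel changes sign at [a + d] and at [b - d], and is [q] with a different
    quadratic on each side of the midpoint, whence four segments.  Each half
    contributes [h ^+ 3 / 6 - d * h ^+ 2 / 4 + d ^+ 3 / 6] where
    [h = (b - a) / 2]. *)
Lemma three_point_rule_le {R : realType} (F f g k : R -> R) (a b d M : R)
    (d_gt0 : 0 < d) (d_lt : d < (b - a) / 2)
    (dF : forall x, x \in `]a, b[%R -> is_derive x 1 F (f x))
    (cF : {within `[a, b], continuous F})
    (df : forall x, x \in `[a, b]%R -> is_derive x 1 f (g x))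
    (dg : forall x, x \in `[a, b]%R -> is_derive x 1 g (k x))
    (kM : forall x, x \in `[a, b]%R -> `|k x| <= M) :
  `|F b - F a - (d / 2 * f a + (b - a - d) * f ((a + b) / 2) + d / 2 * f b)|
    <= M * ((b - a) ^+ 3 / 24 - d * (b - a) ^+ 2 / 8 + d ^+ 3 / 3).
Proof.
have step u v p r e : a <= u -> u < v -> v <= b ->
    (forall x, x \in `]u, v[%R ->
       `|(x - p) * (x - r) / 2| = e * ((x - p) * (x - r) / 2)) ->
    `|peano_increment F f g p r v - peano_increment F f g p r u|
      <= M * e * (peano_area p r v - peano_area p r u).
  move=> au uv vb sign_e.
  have sub x : x \in `[u, v]%R -> x \in `[a, b]%R.
    by rewrite !in_itv/= => /andP[ux xv]; apply/andP; split; lra.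
  have dF' x : x \in `]u, v[%R -> is_derive x 1 F (f x).
    rewrite in_itv/= => /andP[ux xv]; apply: dF.
    by rewrite in_itv/=; apply/andP; split; lra.
  have cF' : {within `[u, v], continuous F}.
    by apply: continuous_subspaceW cF => x; exact: sub.
  exact: (peano_increment_le F f g k u v p r e M uv dF' cF'
    (fun x xuv => df x (sub x xuv)) (fun x xuv => dg x (sub x xuv))
    (fun x xuv => kM x (sub x xuv)) sign_e).
set c := (a + b) / 2; have cE : c = (a + b) / 2 by [].
have s1 : `|peano_increment F f g a (a + d) (a + d)
            - peano_increment F f g a (a + d) a|
    <= M * (-1) * (peano_area a (a + d) (a + d) - peano_area a (a + d) a).
  apply: step; [lra|lra|lra|move=> x; rewrite in_itv/= => /andP[ux xv]].
  have : 0 <= (x - a) * (a + d - x) by apply: mulr_ge0; lra.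
  by move=> sgn; rewrite ler0_norm ?mulN1r//; lra.
have s2 : `|peano_increment F f g a (a + d) c
            - peano_increment F f g a (a + d) (a + d)|
    <= M * 1 * (peano_area a (a + d) c - peano_area a (a + d) (a + d)).
  apply: step; [lra|lra|lra|move=> x; rewrite in_itv/= => /andP[ux xv]].
  have : 0 <= (x - a) * (x - (a + d)) by apply: mulr_ge0; lra.
  by move=> sgn; rewrite ger0_norm ?mul1r//; lra.
have s3 : `|peano_increment F f g b (b - d) (b - d)
            - peano_increment F f g b (b - d) c|
    <= M * 1 * (peano_area b (b - d) (b - d) - peano_area b (b - d) c).
  apply: step; [lra|lra|lra|move=> x; rewrite in_itv/= => /andP[ux xv]].
  have : 0 <= (b - x) * (b - d - x) by apply: mulr_ge0; lra.
  by move=> sgn; rewrite ger0_norm ?mul1r//; lra.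
have s4 : `|peano_increment F f g b (b - d) b
            - peano_increment F f g b (b - d) (b - d)|
    <= M * (-1) * (peano_area b (b - d) b - peano_area b (b - d) (b - d)).
  apply: step; [lra|lra|lra|move=> x; rewrite in_itv/= => /andP[ux xv]].
  have : 0 <= (b - x) * (x - (b - d)) by apply: mulr_ge0; lra.
  by move=> sgn; rewrite ler0_norm ?mulN1r//; lra.
set x1 := (X in `|X| <= _) in s1; set x2 := (X in `|X| <= _) in s2.
set x3 := (X in `|X| <= _) in s3; set x4 := (X in `|X| <= _) in s4.
(* The values of the derivative at the midpoint cancel in this sum. *)
have -> : F b - F a - (d / 2 * f a + (b - a - d) * f c + d / 2 * f b)
    = x1 + x2 + (x3 + x4).
  by rewrite /x1 /x2 /x3 /x4 /peano_increment /c; field.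
have le4 := lerD (lerD s1 s2) (lerD s3 s4).
have tri : `|x1 + x2 + (x3 + x4)| <= `|x1| + `|x2| + (`|x3| + `|x4|).
  by apply: le_trans (ler_normD _ _) (lerD _ _); exact: ler_normD.
apply: le_trans (le_trans tri le4) _.
rewrite le_eqVlt; apply/predU1P; left.
by rewrite /peano_area /c; field.
Qed.

(** [sup] has a meaningful value only on sets that are bounded above; here the
    bound on the larger set [I] provides this. *)
Lemma norm_le_sup_norm_on {R : realType} {a b x : R} {I : set R} {g : R -> R}
    (abI : `[a, b] `<=` I) (gI : [bounded g x | x in I])
    (xab : x \in `[a, b]%R) :
  `|g x| <= sup_norm_on a b g.
Proof.
have [N [_ gN]] := gI.
have {}gN : forall y, I y -> `|g y| <= N + 1 by apply: gN; lra.
apply: ub_le_sup; last by exists x.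
by exists (N + 1) => _ [y yab <-]; exact/gN/abI.
Qed.

Theorem theorem3 (R : realType) (a b : R) (hab : a < b)
    (I : set R) (I_open : open I) (I_itv : is_interval I)
    (abI : `[a, b] `<=` I)
    (f : R -> R) (f_diff : twice_differentiable_on I f)
    (f2_bounded : [bounded f^`(2) x | x in I])
    (f2_integrable :
       (@lebesgue_measure R).-integrable `[a, b] (EFin \o f^`(2))) :
  `| \int[@lebesgue_measure R]_(t in `[a, b]) f t
     - (Num.sqrt 2 / 8 * f a
        + (1 - Num.sqrt 2 / 4) * f ((a + b) / 2)
        + Num.sqrt 2 / 8 * f b) * (b - a) |
  <= (2 - Num.sqrt 2) / 48 * sup_norm_on a b f^`(2) * (b - a) ^+ 3.
Proof.
have df x : x \in `[a, b]%R -> is_derive x 1 f (f^`() x).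
  by move=> /abI/f_diff[fx _]; rewrite derive1E; exact: derivableP.
have dg x : x \in `[a, b]%R -> is_derive x 1 f^`() (f^`(2) x).
  by move=> /abI/f_diff[_ gx]; rewrite /= derive1E; exact: derivableP.
have intf : (@lebesgue_measure R).-integrable `[a, b] (EFin \o f).
  apply: continuous_compact_integrable; first exact: segment_compact.
  by apply: derivable_within_continuous => x /df[].
pose F := parameterized_integral (@lebesgue_measure R) a ^~ f.
have dF x : x \in `]a, b[%R -> is_derive x 1 F (f x).
  move=> xab; have /df[fx _] : x \in `[a, b]%R by exact: subset_itv_oo_cc.
  move: xab; rewrite in_itv/= => /andP[ax xb].
  have cfx : {for x, continuous f}.
    exact/differentiable_continuous/derivable1_diffP.
  have [Fx FxE] := continuous_FTC1_closed xb intf ax cfx.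
  by split; [exact: Fx|rewrite -derive1E; exact: FxE].
have cF : {within `[a, b], continuous F}.
  by apply: parameterized_integral_continuous => //; exact: ltW.
have Fa : F a = 0 by rewrite /F /parameterized_integral set_itv1 Rintegral_set1.
set s := Num.sqrt 2.
have s2 : s ^+ 2 = 2 by rewrite sqr_sqrtr.
have s_gt0 : 0 < s by rewrite sqrtr_gt0.
have s_lt2 : s < 2 by nra.
have kM x : x \in `[a, b]%R -> `|f^`(2) x| <= sup_norm_on a b f^`(2).
  exact: norm_le_sup_norm_on abI f2_bounded.
have := @three_point_rule_le _ F f f^`() f^`(2) a b (s / 4 * (b - a))
  (sup_norm_on a b f^`(2)).
have d_gt0 : 0 < s / 4 * (b - a) by apply: mulr_gt0; lra.
have d_lt : s / 4 * (b - a) < (b - a) / 2 by nra.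
move=> /(_ d_gt0 d_lt dF cF df dg kM).
have -> : \int[@lebesgue_measure R]_(t in `[a, b]) f t = F b by [].
rewrite Fa; set M := sup_norm_on _ _ _ => rule.
have s3 : s ^+ 3 = 2 * s by rewrite exprS s2 mulrC.
have area : (b - a) ^+ 3 / 24 - s / 4 * (b - a) * (b - a) ^+ 2 / 8
    + (s / 4 * (b - a)) ^+ 3 / 3 = (2 - s) / 48 * (b - a) ^+ 3.
  by rewrite !exprMn s3; field.
move: rule; rewrite area => rule.
apply: le_trans (le_trans rule _).
  by rewrite le_eqVlt; apply/predU1P; left; congr `| _ |; field.
by rewrite le_eqVlt; apply/predU1P; left; ring.
Qed.
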